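(* Let $\theta\in[0,2\pi)$ with $\theta\ne\frac{n\pi}{2}$ for $n=0,1,2,3$. For $0<p<1$ put $q=1-p$ and let $M_{2n}=M_{2n}(p)$ denote the $2n$-th moment of the probability distribution on $\mathbb{R}$ with characteristic function $$\varphi(\nu)=\frac{1}{2\pi}\int_0^{2\pi}e^{-\frac12\,\frac{1+2q\cos(k)+q^2}{1-q^2}\cot^2(\theta)\,\nu^2}\,dk .$$ Then for every $n=0,1,2,\dots$ the critical exponent of $M_{2n}$ at $p=0$ is $$\gamma_{2n}:=\lim_{p\to0^+}-\frac{\ln M_{2n}}{\ln p}=n .$$ In particular it does not depend on $\theta$.
   Context: The distribution with characteristic function $\varphi$ arises as the limiting distribution, under the scaling $x\mapsto x/\sqrt t$, of the position of the decoherent quantum walk on $\mathbb{Z}$ with decoherence rate $p$ and coin operator $U\in O(2)$ given by $\begin{pmatrix}\cos\theta&-\sin\theta\\ \sin\theta&\cos\theta\end{pmatrix}$ or $\begin{pmatrix}\cos\theta&\sin\theta\\ \sin\theta&-\cos\theta\end{pmatrix}$. The characteristic function of a probability measure $\mu$ is $\varphi(\nu)=\int e^{i\nu x}\,d\mu(x)$, and its $n$-th moment is $\int x^n\,d\mu(x)$. *)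

(* Defs.v *)
From mathcomp Require Import all_boot all_order all_algebra.
From mathcomp Require Import all_classical all_reals all_analysis.
From mathcomp Require Import complex.

Set Implicit Arguments.
Unset Strict Implicit.
Unset Printing Implicit Defensive.

Import Order.TTheory GRing.Theory Num.Theory.
Import numFieldNormedType.Exports.

Local Open Scope classical_set_scope.
Local Open Scope ring_scope.
Local Open Scope complex_scope.

Definition cot {R : realType} (x : R) : R := cos x / sin x.

(* The integral of x |-> e^(i nu x) = cos (nu x) + i sin (nu x), taken
   componentwise, as the library integrates real-valued functions only. *)
Definition char_fun {R : realType} (mu : probability (measurableTypeR R) R)
    (nu : R) : R[i] :=
  (\int[mu]_x cos (nu * x)) +i* (\int[mu]_x sin (nu * x)).

Definition moment {R : realType} (mu : probability (measurableTypeR R) R)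
    (n : nat) : R :=
  \int[mu]_x x ^+ n.

Definition phi {R : realType} (theta p nu : R) : R :=
  let q := 1 - p in
  (2 * pi)^-1 * \int[lebesgue_measure]_(k in `[0, 2 * pi])
    expR (- 2^-1 * ((1 + 2 * q * cos k + q ^+ 2) / (1 - q ^+ 2))
          * cot theta ^+ 2 * nu ^+ 2).

(* Main.v *)
Require Import Defs.
From mathcomp Require Import all_boot all_order all_algebra.
From mathcomp Require Import all_classical all_reals all_analysis.
From mathcomp Require Import complex measurable_realfun ring lra zify.

(** The second difference [D_h f x = 2 f x - f (x + h) - f (x - h)] satisfies
    [D_h^n (cos (. x)) 0 = (2 - 2 cos (h x))^n], so that the integral of
    [(2 - 2 cos (h x))^n] against a measure is [D_h^n] of its characteristic
    function at [0].

    Upper bound: [phi] is an average of Gaussians [exp (- a_k nu^2)] with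
    [a_k <= cot^2 theta / p].  Since [D_h^n] kills polynomials of degree less
    than [2n], only the Taylor remainder of the Gaussian contributes, and
    [D_h^n phi 0 = O (h^(2n) / p^n)] uniformly in [h].  Letting [h] tend to [0],
    Fatou's lemma gives that [M_(2n)] is finite and [O (p^-n)].

    Lower bound: [2 - 2 cos t <= t^2] gives [h^2 M_2 >= D_h phi 0], which for
    [h^2 = p / cot^2 theta] is at least [1 / 4]; then [M_(2n) >= M_2^n] by
    convexity of [t |-> t^n]. *)

Set Implicit Arguments.
Unset Strict Implicit.
Unset Printing Implicit Defensive.

Import Order.TTheory GRing.Theory Num.Theory.
Import numFieldNormedType.Exports.

Local Open Scope classical_set_scope.
Local Open Scope ring_scope.
Local Open Scope complex_scope.

(** * Iterated second differences of polynomials, Gaussians and integrals *)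

Section SecondDifference.
Context {R : realType}.
Implicit Types (f g : R -> R) (h x y : R).

Definition diff2 h f : R -> R := fun x => 2 * f x - f (x + h) - f (x - h).

Lemma iter_diff2_cos h x n y :
  iter n (diff2 h) (fun z => cos (z * x)) y =
  (2 - 2 * cos (h * x)) ^+ n * cos (y * x).
Proof.
elim: n y => [|n IH] y; first by rewrite expr0 mul1r.
by rewrite iterS /diff2 !IH (mulrDl y h) (mulrBl x y h) cosD cosB exprS; ring.
Qed.

Lemma iter_diff2B h n f g x :
  iter n (diff2 h) (fun y => f y - g y) x =
  iter n (diff2 h) f x - iter n (diff2 h) g x.
Proof.
by elim: n x => [//|n IH] x; rewrite !iterS /diff2 !IH; ring.
Qed.

Lemma iter_diff2Z h n (c : R) f x :
  iter n (diff2 h) (fun y => c * f y) x = c * iter n (diff2 h) f x.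
Proof.
by elim: n x => [//|n IH] x; rewrite !iterS /diff2 !IH; ring.
Qed.

(** The coefficients 2, -1, -1 have absolute sum 4, and each application looks a distance [h]
    further from [x]. *)
Lemma le_norm_iter_diff2 h n f x (M : R) : 0 <= h ->
  (forall y, `|y - x| <= n%:R * h -> `|f y| <= M) ->
  `|iter n (diff2 h) f x| <= 4 ^+ n * M.
Proof.
move=> h0; elim: n x => [|n IH] x fM.
  by rewrite expr0 mul1r fM// subrr normr0 mul0r.
have shift t : `|t| <= h -> `|iter n (diff2 h) f (x + t)| <= 4 ^+ n * M.
  move=> th; apply: IH => y yx; apply: fM; rewrite -natr1 mulrDl mul1r.
  have -> : y - x = (y - (x + t)) + t by ring.
  by rewrite (le_trans (ler_normD _ _))// lerD.
have H0 := shift 0; rewrite addr0 normr0 in H0.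
have Hp := shift h; rewrite (ger0_norm h0) in Hp.
have Hm := shift (- h); rewrite normrN (ger0_norm h0) in Hm.
move: {H0 Hp Hm} (H0 h0) (Hp (lexx _)) (Hm (lexx _)).
rewrite iterS /diff2 exprS -mulrA !ler_norml.
by move=> /andP[? ?] /andP[? ?] /andP[? ?]; apply/andP; split; lra.
Qed.

(** The leading terms cancel. In Horner form the difference for [Q * 'X + c] is the difference for
    [Q] times ['X], plus [h] times the shift of [Q], which makes the induction go through. *)
Lemma size_comp_polyXaddC_sub (P : {poly R}) h :
  (size (P \Po ('X + h%:P) - P)%R <= (size P).-1)%N.
Proof.
elim/poly_ind: P => [|Q c IH].
  by rewrite comp_poly0 subr0 size_poly0.
have -> : (Q * 'X + c%:P) \Po ('X + h%:P) - (Q * 'X + c%:P) =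
    (Q \Po ('X + h%:P) - Q) * 'X + h *: (Q \Po ('X + h%:P)).
  by rewrite comp_polyD comp_polyM comp_polyX comp_polyC -mul_polyC; ring.
rewrite size_MXaddC.
have [->|Q0] := eqVneq Q 0.
  by rewrite comp_poly0 subrr mul0r scaler0 addr0 size_poly0.
rewrite (leq_trans (size_polyD _ _))// geq_max; apply/andP; split.
  rewrite (leq_trans (size_polyMleq _ _))// size_polyX addnC /= add1n.
  by rewrite (leq_ltn_trans IH)// prednK// size_poly_gt0.
by rewrite (leq_trans (size_scale_leq _ _))// size_comp_poly2// size_XaddC.
Qed.

Lemma iter_diff2_poly h n (P : {poly R}) :
  exists2 Q : {poly R}, (size Q <= size P - n.*2)%N &
    iter n (diff2 h) (horner P) =1 horner Q.
Proof.
elim: n => [|n [Q sQ IH]]; first by exists P; rewrite ?subn0.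
(* Shifting back by [h] first turns the central second difference into minus two successive forward
   differences, each of which lowers the size by one. *)
pose S := Q \Po ('X + (- h)%:P).
pose T := S \Po ('X + h%:P) - S.
exists (- (T \Po ('X + h%:P) - T)).
  rewrite size_polyN (leq_trans (size_comp_polyXaddC_sub _ _))//.
  have sT : (size T <= (size Q).-1)%N.
    rewrite (leq_trans (size_comp_polyXaddC_sub _ _))//.
    by rewrite [size S]size_comp_poly2 ?size_XaddC.
  by lia.
move=> x; rewrite iterS /diff2 !IH /T /S !hornerE.
rewrite !horner_comp !hornerE !horner_comp !hornerE.
have e1 : x + h + h - h = x + h by ring.
have e2 : x + h - h = x by ring.
rewrite e1 e2; ring.
Qed.

Lemma iter_diff2_poly_eq0 h n (P : {poly R}) x : (size P <= n.*2)%N ->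
  iter n (diff2 h) (horner P) x = 0.
Proof.
move=> sP; have [Q sQ ->] := iter_diff2_poly h n P.
move: sQ; rewrite (eqP (_ : size P - n.*2 == 0)%N) ?subn_eq0//.
by rewrite leqn0 size_poly_eq0 => /eqP ->; rewrite horner0.
Qed.

(** [P] is the Taylor polynomial at 0; the cruder bound without [n!] is enough. The derivative of
    the remainder of order [n + 1] is minus the remainder of order [n], so the mean value theorem
    gains one factor [x]. *)
Lemma expRN_poly_approx n : exists2 P : {poly R}, (size P <= n)%N &
  forall x, 0 <= x -> `|expR (- x) - P.[x]| <= x ^+ n.
Proof.
pose P m : {poly R} := \poly_(i < m) ((-1) ^+ i / i`!%:R).
exists (P n) => [|]; first exact: size_poly.
elim: n => [|n IH] x x0.
  rewrite /P poly_def big_ord0 horner0 subr0 expr0 ger0_norm ?expR_ge0//.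
  by rewrite expR_le1 oppr_le0.
have dP : (P n.+1)^`() = - P n.
  apply/polyP => i; rewrite coef_deriv coefN !coef_poly ltnS.
  case: ifP => // _; last by rewrite mul0rn oppr0.
  rewrite factS natrM exprS invfM -mulr_natr.
  by field; rewrite nat1r !pnatr_eq0 -!lt0n fact_gt0.
pose f := (fun y => expR (- y) - (P n.+1).[y]).
have df (y : R) : is_derive y (1 : R) f (- (expR (- y) - (P n).[y])).
  rewrite /f; apply: is_derive_eq; rewrite dP hornerN.
  by ring.
have cf : {within `[0, x], continuous f}.
  apply: derivable_within_continuous => y _.
  by have [] := df y.
have [c /[!in_itv]/= /andP[c0 cx]] := MVT_segment x0 (fun y _ => df y) cf.
have -> : f 0 = 0.
  by rewrite /f oppr0 expR0 horner_coef0 coef_poly /= expr0 fact0 divr1 subrr.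
rewrite !subr0 {1}/f => ->; rewrite normrM normrN (ger0_norm x0) exprSr.
by rewrite ler_wpM2r// (le_trans (IH _ c0))// lerXn2r// nnegrE.
Qed.

(** The Taylor polynomial in [a * y ^+ 2] has degree below [2n] in [y], so it can be subtracted for
    free. What is left is at most [(a * y ^+ 2) ^+ n] at the points within [n * h] of 0. *)
Lemma le_norm_iter_diff2_gauss h n (a : R) : 0 <= h -> 0 <= a ->
  `|iter n (diff2 h) (fun y => expR (- (a * y ^+ 2))) 0| <=
  (4 * a * (n%:R * h) ^+ 2) ^+ n.
Proof.
move=> h0 a0; have [P sP PE] := expRN_poly_approx n.
pose Q := P \Po (a *: 'X^2).
have sQ : (size Q <= n.*2)%N.
  (* [size_comp_poly] relates predecessors of sizes, so zero polynomials are treated apart. *)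
  have [P0|P0] := eqVneq P 0; first by rewrite /Q P0 comp_poly0 size_poly0.
  have sX : ((size (a *: 'X^2 : {poly R})).-1 <= 2)%N.
    by rewrite -subn1 leq_subLR (leq_trans (size_scale_leq _ _))// size_polyXn.
  have /(leq_mul (leqnn (size P).-1)) := sX.
  rewrite -size_comp_poly -/Q => H.
  have : ((size P).-1 < n)%N.
    by rewrite (leq_trans _ sP)// prednK// size_poly_gt0.
  have [->//|Q0] := eqVneq Q 0; first by rewrite size_poly0.
  move=> Pn; rewrite -(prednK (_ : 0 < size Q)%N) ?size_poly_gt0//.
  by rewrite (leq_ltn_trans H)// -muln2 ltn_pmul2r.
have -> : iter n (diff2 h) (fun y => expR (- (a * y ^+ 2))) 0 =
    iter n (diff2 h) (fun y => expR (- (a * y ^+ 2)) - Q.[y]) 0.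
  by rewrite iter_diff2B iter_diff2_poly_eq0// subr0.
rewrite -mulrA exprMn; apply: le_norm_iter_diff2 => // y; rewrite subr0 => yn.
have y2 : y ^+ 2 <= (n%:R * h) ^+ 2.
  by rewrite -real_normK ?num_real// lerXn2r// nnegrE// mulr_ge0.
have -> : Q.[y] = P.[a * y ^+ 2] by rewrite horner_comp !hornerE.
have ay : 0 <= a * y ^+ 2 by rewrite mulr_ge0// sqr_ge0.
rewrite (le_trans (PE _ ay))// lerXn2r// ?nnegrE// ?mulr_ge0 ?sqr_ge0//.
exact: ler_wpM2l.
Qed.

(** Integrability is proved together with the exchange, because linearity of the integral at each
    induction step relies on it. *)
Lemma iter_diff2_Rintegral d (T : measurableType d)
    (mu : {measure set T -> \bar R}) (D : set T) (F : R -> T -> R) h n y :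
  measurable D -> (forall z, mu.-integrable D (EFin \o F z)) ->
  mu.-integrable D (EFin \o (fun w => iter n (diff2 h) (F^~ w) y)) /\
  iter n (diff2 h) (fun z => \int[mu]_(w in D) F z w) y =
  \int[mu]_(w in D) iter n (diff2 h) (F^~ w) y.
Proof.
move=> mD iF; elim: n y => [|n IH] y.
  by split; [exact: iF|].
have [[[i0 e0] [ip ep]] [im em]] := (IH y, IH (y + h), IH (y - h)).
pose G z (w : T) := iter n (diff2 h) (F^~ w) z.
have i2 : mu.-integrable D (EFin \o (fun w => 2 * G y w)).
  have := integrableZl mD 2 i0.
  by apply: eq_integrable => // w _; rewrite /= EFinM.
have i2p : mu.-integrable D (EFin \o (fun w => 2 * G y w - G (y + h) w)).
  exact: (integrableB mD i2 ip).
split; first by exact: (integrableB mD i2p im).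
by rewrite iterS /diff2 e0 ep em -RintegralZl// -!RintegralB.
Qed.

End SecondDifference.

(** * Even moments of a probability measure *)

Section EvenMoments.
Context {R : realType}.
Implicit Types (mu : probability (measurableTypeR R) R) (x h B : R).

Lemma two_sub_2cosE x : 2 - 2 * cos x = 4 * sin (x / 2) ^+ 2.
Proof.
have {1}-> : x = (x / 2) *+ 2 by rewrite -mulr_natr; field.
by rewrite cos_mulr2n cos2sin2; ring.
Qed.

Lemma two_sub_2cos_ge0 x : 0 <= 2 - 2 * cos x.
Proof. by have := cos_le1 x; lra. Qed.

(** By the half-angle formula the quotient is the square of [2 * sin (u m * (x / 2)) / u m], whose
    limit is twice the derivative of [t |-> sin (t * (x / 2))] at 0. *)
Lemma cvg_two_sub_2cos x (u : R ^nat) :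
  (forall m, u m != 0) -> u m @[m --> \oo] --> 0 ->
  (2 - 2 * cos (u m * x)) / u m ^+ 2 @[m --> \oo] --> x ^+ 2.
Proof.
move=> u0 ucv.
have ds : is_derive 0 (1 : R) (fun t => sin (t * (x / 2))) (x / 2).
  apply: is_derive_eq.
  by rewrite mul0r cos0 mul1r scaler0 add0r -[_%:A]/(_ * 1) mulr1.
have [ds1 ds2] := ds.
have : (u m)^-1 * sin (u m * (x / 2)) @[m --> \oo] --> x / 2.
  have /cvgr_dnbhsP/(_ u (conj u0 ucv)) :
     t^-1 * sin (t * (x / 2)) @[t --> 0^'] --> x / 2.
    rewrite -[X in _ --> X]ds2; apply: cvg_trans ds1.
    apply: near_eq_cvg; near=> t => /=.
    by rewrite mul0r sin0 subr0 addr0 -[t *: 1]/(t * 1) mulr1.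
  by [].
move=> H0.
have H : 2 * ((u m)^-1 * sin (u m * (x / 2))) @[m --> \oo] --> 2 * (x / 2).
  by apply: cvgM => //; exact: cvg_cst.
have -> : x ^+ 2 = 2 * (x / 2) * (2 * (x / 2)) by field.
rewrite (_ : (fun m => _) = (fun m => 2 * ((u m)^-1 * sin (u m * (x / 2))) *
  (2 * ((u m)^-1 * sin (u m * (x / 2)))))); first exact: cvgM.
apply/funext => m; rewrite two_sub_2cosE -(mulrA (u m) x).
by field; exact: u0.
Unshelve. all: by end_near. Qed.

Lemma continuous_two_sub_2cosX h n :
  continuous (fun x => (2 - 2 * cos (h * x)) ^+ n).
Proof.
move=> x; apply: (@continuous_comp _ _ _ (fun x => 2 - 2 * cos (h * x))
  (fun y => y ^+ n)); last exact: exprn_continuous.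
apply: cvgB; first exact: cvg_cst.
apply: cvgM; first exact: cvg_cst.
apply: (@continuous_comp _ _ _ (fun x => h * x) cos).
  exact: mulrl_continuous.
exact: continuous_cos.
Qed.

Lemma integrable_bounded mu (f : R -> R) (M : R) :
  continuous f -> (forall x, `|f x| <= M) ->
  mu.-integrable [set: measurableTypeR R] (EFin \o f).
Proof.
move=> cf fM; apply: (@le_integrable _ _ _ _ _ _ _ (EFin \o cst M)) => //.
- by apply/measurable_EFinP; exact: continuous_measurable_fun.
- by move=> x _ /=; rewrite lee_fin (le_trans (fM x))// ler_norm.
- exact: finite_measure_integrable_cst.
Qed.

Lemma integrable_two_sub_2cosX mu h n :
  mu.-integrable [set: measurableTypeR R]
    (EFin \o (fun x => (2 - 2 * cos (h * x)) ^+ n)).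
Proof.
apply: (@integrable_bounded _ _ (4 ^+ n)).
  exact: continuous_two_sub_2cosX.
move=> x; rewrite normrX lerXn2r// ?nnegrE//.
rewrite ger0_norm ?two_sub_2cos_ge0//.
by have := cos_geN1 (h * x); lra.
Qed.

(** Fatou's lemma along [h = 1 / (m + 1)]. The conclusion is about the extended real integral, so
    that it yields finiteness of the moment as well as its bound. *)
Lemma integral_pow_le mu n B :
  (forall h, 0 < h ->
    \int[mu]_x (2 - 2 * cos (h * x)) ^+ n <= B * h ^+ 2 ^+ n) ->
  (\int[mu]_x (x ^+ (2 * n))%:E <= B%:E)%E.
Proof.
move=> HB.
pose u (m : nat) : R := m.+1%:R^-1.
have u0 m : 0 < u m by rewrite /u invr_gt0.
pose f m x := (2 - 2 * cos (u m * x)) / u m ^+ 2.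
have f0 m x : 0 <= f m x by rewrite divr_ge0 ?two_sub_2cos_ge0// sqr_ge0.
have fn m : (\int[mu]_x (f m x ^+ n)%:E)%E =
    ((u m ^+ 2 ^+ n)^-1 * \int[mu]_x (2 - 2 * cos (u m * x)) ^+ n)%:E.
  rewrite EFinM /Rintegral fineK; last first.
    by apply: integrable_fin_num => //; exact: integrable_two_sub_2cosX.
  rewrite -integralZl//; last exact: integrable_two_sub_2cosX.
  by apply: eq_integral => x _; rewrite -EFinM /f expr_div_n mulrC.
have mf m : measurable_fun [set: measurableTypeR R]
    (EFin \o (fun x => f m x ^+ n)).
  apply/measurable_EFinP; apply: continuous_measurable_fun.
  move=> x; rewrite /f; under eq_fun do rewrite expr_div_n.
  apply: cvgM; last exact: cvg_cst.
  exact: continuous_two_sub_2cosX.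
have nf m x : setT x -> (0 <= (EFin \o (fun x => (f m x ^+ n)%R)) x)%E.
  by move=> _; rewrite lee_fin exprn_ge0.
have F := fatou mu measurableT mf nf.
have -> : (\int[mu]_x (x ^+ (2 * n))%:E =
   \int[mu]_x limn_einf (fun m => (f m x ^+ n)%:E))%E.
  apply: eq_integral => x _; apply/esym.
  (* The lower limit of a convergent sequence is its limit. *)
  apply: (cvg_limn_einf_sup _).1; apply: cvg_EFin; first by near=> m.
  rewrite exprM; apply: (@cvg_comp _ _ _ (fun m => f m x) (fun y => y ^+ n)
    _ (nbhs (x ^+ 2))); last exact: exprn_continuous.
  apply: cvg_two_sub_2cos => [m|]; first by rewrite gt_eqF.
  exact: cvg_harmonic.
apply: le_trans F _.
(* The lower limit is the limit of the infima over tails; each infimum is at most the first term of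
   its tail, hence at most [B]. *)
rewrite limn_einf_lim; apply: lime_le; first exact: is_cvg_einfs.
near=> m; apply: (@le_trans _ _ (\int[mu]_x (f m x ^+ n)%:E)%E).
  by apply: ereal_inf_lbound; exists m => /=.
rewrite fn lee_fin mulrC ler_pdivrMr ?HB// exprn_gt0// exprn_gt0//.
Unshelve. all: by end_near. Qed.

Lemma integrable_pow mu n B : (\int[mu]_x (x ^+ (2 * n))%:E <= B%:E)%E ->
  mu.-integrable [set: measurableTypeR R] (EFin \o (fun x => x ^+ (2 * n))).
Proof.
move=> H; apply/integrableP; split.
  apply/measurable_EFinP; apply: continuous_measurable_fun.
  exact: exprn_continuous.
rewrite (le_lt_trans _ (ltry B))// (le_trans _ H)//.
rewrite le_eqVlt; apply/orP; left; apply/eqP; apply: eq_integral => x _ /=.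
by rewrite ger0_norm// exprM exprn_ge0// sqr_ge0.
Qed.

Lemma sin_le_id x : 0 <= x -> sin x <= x.
Proof.
move=> x0.
have [c _] := MVT_segment x0 (fun y _ => is_derive_sin y)
  (continuous_subspaceT (@continuous_sin R)).
by rewrite sin0 !subr0 => ->; rewrite ler_piMl// cos_le1.
Qed.

Lemma two_sub_2cos_le x : 2 - 2 * cos x <= x ^+ 2.
Proof.
wlog x0 : x / 0 <= x => [H|].
  have [/H//|/ltW x0] := leP 0 x.
  by rewrite -cosN -sqrrN; apply: H; rewrite oppr_ge0.
have x20 : 0 <= x / 2 by rewrite divr_ge0.
have s1 := sin_le_id x20.
have s2 : - (x / 2) <= sin (x / 2).
  (* Up to [pi] the sine is nonnegative; beyond, [x / 2] exceeds 1 and [sin >= -1] suffices. *)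
  have [?|] := leP (x / 2) pi.
    by rewrite (@le_trans _ _ 0)// ?oppr_le0// sin_ge0_pi// x20.
  by have := sin_geN1 (x / 2); have := pi_ge2 R; lra.
by rewrite two_sub_2cosE; nra.
Qed.

(** Convexity of the power function on the nonnegative half-line. Multiplying the induction
    hypothesis by [t] overshoots the next tangent by [(n + 1) * m ^+ n * (t - m) ^+ 2]. *)
Lemma pow_ge_tangent n (m t : R) : 0 <= m -> 0 <= t ->
  m ^+ n.+1 + n.+1%:R * m ^+ n * (t - m) <= t ^+ n.+1.
Proof.
move=> m0 t0; elim: n => [|n IH]; first by rewrite !expr1 expr0; lra.
have := ler_wpM2r t0 IH; rewrite -exprSr; apply: le_trans.
rewrite [m ^+ n.+2]exprS [m ^+ n.+1]exprS -[n.+2%:R]natr1.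
have : 0 <= n.+1%:R * m ^+ n * (t - m) ^+ 2.
  by rewrite mulr_ge0 ?sqr_ge0// mulr_ge0// exprn_ge0.
by set c := m ^+ n; set k := n.+1%:R; nra.
Qed.

(** Jensen's inequality: integrate the tangent inequality at [m = M_2] with [t = x ^+ 2]; the linear
    term has mean zero. *)
Lemma moment_ge_exprn mu n :
  mu.-integrable [set: measurableTypeR R] (EFin \o (fun x => x ^+ 2)) ->
  mu.-integrable [set: measurableTypeR R] (EFin \o (fun x => x ^+ (2 * n))) ->
  moment mu 2 ^+ n <= moment mu (2 * n).
Proof.
case: n => [|n] i2 in'.
  by rewrite muln0 expr0 /moment; under eq_Rintegral do rewrite expr0;
    rewrite Rintegral_cst// mul1r [X in fine X]probability_setT.
set m := moment mu 2.
have m0 : 0 <= m by apply: Rintegral_ge0 => x _; rewrite sqr_ge0.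
have ic (c : R) : mu.-integrable [set: measurableTypeR R] (EFin \o cst c).
  exact: finite_measure_integrable_cst.
set k := n.+1%:R * m ^+ n.
have iB : mu.-integrable [set: measurableTypeR R]
    (EFin \o (fun x => x ^+ 2 - m)).
  exact: (integrableB measurableT i2 (ic m)).
have ik : mu.-integrable [set: measurableTypeR R]
    (EFin \o (fun x => k * (x ^+ 2 - m))).
  have := integrableZl measurableT k iB.
  by apply: eq_integrable => // x _; rewrite /= EFinM.
have iD : mu.-integrable [set: measurableTypeR R]
    (EFin \o (fun x => m ^+ n.+1 + k * (x ^+ 2 - m))).
  exact: (integrableD measurableT (ic _) ik).
have cstE (c : R) : \int[mu]_x c = c.
  by rewrite Rintegral_cst// [X in fine X]probability_setT mulr1.
have -> : m ^+ n.+1 = \int[mu]_x (m ^+ n.+1 + k * (x ^+ 2 - m)).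
  rewrite (RintegralD measurableT (ic _) ik) RintegralZl//.
  rewrite (RintegralB measurableT i2 (ic m)) !cstE.
  by rewrite -/(moment mu 2) -/m subrr mulr0 addr0.
apply: le_Rintegral => // x _; rewrite exprM.
by apply: pow_ge_tangent => //; exact: sqr_ge0.
Qed.

End EvenMoments.

(** * Bounds on [phi] and on the moments, and the critical exponent *)

Section CriticalExponent.
Context {R : realType}.
Implicit Types (theta p q h k : R).

Lemma integral_two_sub_2cosX (mu : probability (measurableTypeR R) R)
    (f : R -> R) h n :
  (forall y, \int[mu]_x cos (y * x) = f y) ->
  \int[mu]_x (2 - 2 * cos (h * x)) ^+ n = iter n (diff2 h) f 0.
Proof.
move=> fE; have <- : (fun y => \int[mu]_x cos (y * x)) = f by exact/funext.
have icos y : mu.-integrable [set: measurableTypeR R]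
    (EFin \o (fun x => cos (y * x))).
  apply: (@integrable_bounded _ _ _ 1) => [x|x]; last exact: cos_max.
  apply: (@continuous_comp _ _ _ (fun x => y * x) cos).
    exact: mulrl_continuous.
  exact: continuous_cos.
have [_ ->] := iter_diff2_Rintegral h n 0 measurableT icos.
by apply: eq_Rintegral => x _; rewrite iter_diff2_cos mul0r cos0 mulr1.
Qed.

(** The coefficient [a_k] of the overview. *)
Definition weight theta p k : R :=
  let q := 1 - p in
  2^-1 * ((1 + 2 * q * cos k + q ^+ 2) / (1 - q ^+ 2)) * cot theta ^+ 2.

Lemma phiE theta p nu : phi theta p nu =
  (2 * pi)^-1 * \int[lebesgue_measure]_(k in `[0, 2 * pi])
    expR (- (weight theta p k * nu ^+ 2)).
Proof.
by rewrite /phi /weight; congr (_ * _); apply: eq_Rintegral => k _;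
  congr expR; rewrite !mulNr.
Qed.

Lemma weight_bounds theta p k : 0 < p < 1 ->
  0 <= weight theta p k <= cot theta ^+ 2 / p.
Proof.
move=> /andP[p0 p1]; rewrite /weight /=.
have c0 : 0 <= cot theta ^+ 2 by exact: sqr_ge0.
have d0 : 0 < 1 - (1 - p) ^+ 2 by nra.
have := cos_le1 k; have := cos_geN1 k => c1 c2.
have w0 : 0 <= (1 + 2 * (1 - p) * cos k + (1 - p) ^+ 2) / (1 - (1 - p) ^+ 2).
  by rewrite divr_ge0 ?(ltW d0)//; nra.
have w1 :
    (1 + 2 * (1 - p) * cos k + (1 - p) ^+ 2) / (1 - (1 - p) ^+ 2) <= 2 / p.
  rewrite ler_pdivrMr// [leRHS]mulrAC ler_pdivlMr//.
  (* The numerator is at most [(1 + q)^2 <= 2 (1 + q)], and the denominator is [p (1 + q)], where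
     [1 + q = 2 - p]. *)
  have N : 1 + 2 * (1 - p) * cos k + (1 - p) ^+ 2 <= 2 * (2 - p) by nra.
  by apply: le_trans (ler_wpM2r (ltW p0) N) _; nra.
apply/andP; split; first by rewrite mulr_ge0// mulr_ge0// invr_ge0.
rewrite [_ / p]mulrC ler_wpM2r//.
by rewrite -ler_pdivlMl ?invr_gt0// invrK.
Qed.

Lemma continuous_weight theta p : continuous (weight theta p).
Proof.
move=> k; rewrite /weight; apply: cvgM; last exact: cvg_cst.
apply: cvgM; first exact: cvg_cst.
apply: cvgM; last exact: cvg_cst.
apply: cvgD; last exact: cvg_cst.
apply: cvgD; first exact: cvg_cst.
apply: cvgM; first exact: cvg_cst.
exact: continuous_cos.
Qed.

Lemma integrable_period (f : R -> R) : continuous f ->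
  lebesgue_measure.-integrable `[0, 2 * pi] (EFin \o f).
Proof.
move=> cf; apply: continuous_compact_integrable; first exact: segment_compact.
exact: continuous_subspaceT.
Qed.

Lemma integrable_gauss_weight theta p y :
  lebesgue_measure.-integrable `[0, 2 * pi]
    (EFin \o (fun k => expR (- (weight theta p k * y ^+ 2)))).
Proof.
apply: integrable_period => k.
apply: (@continuous_comp _ _ _ (fun k => - (weight theta p k * y ^+ 2)) expR);
  last exact: continuous_expR.
apply: cvgN; apply: cvgM; last exact: cvg_cst.
exact: continuous_weight.
Qed.

Lemma mean_cst (c : R) :
  (2 * pi)^-1 * \int[lebesgue_measure]_(k in `[0, 2 * pi]) c = c :> R.
Proof.
rewrite Rintegral_cst//= lebesgue_measure_itv/= lte_fin.
have pi20 : 0 < 2 * pi :> R by rewrite mulr_gt0// pi_gt0.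
by rewrite pi20 oppr0 adde0 /fine mulrCA mulVf ?mulr1// gt_eqF.
Qed.

Lemma mean_cos :
  \int[lebesgue_measure]_(k in `[0, 2 * pi]) cos k = 0 :> R.
Proof.
rewrite /Rintegral (@continuous_FTC2 _ _ (@sin R)).
- by rewrite mulr_natl sin2pi sin0 subee.
- by rewrite mulr_gt0// pi_gt0.
- by apply: continuous_subspaceT; exact: continuous_cos.
- split=> [k _||].
  + exact: derivable_sin.
  + by apply: cvg_at_right_filter; exact: continuous_sin.
  + by apply: cvg_at_left_filter; exact: continuous_sin.
- by move=> k _; rewrite derive1E derive_val.
Qed.

Lemma iter_diff2_phi theta p h n :
  lebesgue_measure.-integrable `[0, 2 * pi] (EFin \o (fun k =>
    iter n (diff2 h) (fun y => expR (- (weight theta p k * y ^+ 2))) 0)) /\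
  iter n (diff2 h) (phi theta p) 0 =
  (2 * pi)^-1 * \int[lebesgue_measure]_(k in `[0, 2 * pi])
    iter n (diff2 h) (fun y => expR (- (weight theta p k * y ^+ 2))) 0.
Proof.
have [i e] := @iter_diff2_Rintegral R _ (measurableTypeR R) lebesgue_measure
  `[0, 2 * pi]%classic (fun y k => expR (- (weight theta p k * y ^+ 2))) h n 0
  (measurable_itv _) (integrable_gauss_weight theta p).
split=> //; rewrite -[in RHS]e -iter_diff2Z; congr (iter _ _ _ _).
by apply/funext => y; rewrite phiE.
Qed.

(** The Gaussian estimate with [a_k <= cot^2 theta / p], averaged over [k]. At [n = 0] the constant
    is [0 ^+ 0 = 1], which is the total mass. *)
Lemma iter_diff2_phi_le theta p h n : 0 < p < 1 -> 0 < h ->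
  iter n (diff2 h) (phi theta p) 0 <=
  (4 * cot theta ^+ 2 * n%:R ^+ 2) ^+ n / p ^+ n * h ^+ 2 ^+ n.
Proof.
move=> p01 h0; have /andP[p0 _] := p01.
have [i ->] := iter_diff2_phi theta p h n.
set C := _ * h ^+ 2 ^+ n; rewrite -[leRHS]mean_cst.
rewrite ler_wpM2l ?invr_ge0 ?mulr_ge0 ?pi_ge0//; apply: le_Rintegral => //.
  by apply: integrable_period; exact: cst_continuous.
move=> k _; have /andP[w0 w1] := weight_bounds theta k p01.
apply: le_trans (ler_norm _) _.
apply: le_trans (le_norm_iter_diff2_gauss n (ltW h0) w0) _.
rewrite /C -expr_div_n -exprMn lerXn2r// ?nnegrE.
- by rewrite mulr_ge0 ?sqr_ge0// mulr_ge0.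
- rewrite mulr_ge0 ?sqr_ge0// divr_ge0 ?(ltW p0)//.
  by rewrite mulr_ge0 ?sqr_ge0// mulr_ge0 ?sqr_ge0.
have -> : 4 * cot theta ^+ 2 * n%:R ^+ 2 / p * h ^+ 2 =
    4 * (cot theta ^+ 2 / p) * (n%:R * h) ^+ 2 by ring.
by rewrite ler_wpM2r ?sqr_ge0// ler_wpM2l.
Qed.

(** On the unit interval [exp (-y) <= 1 / (1 + y)], and [(1 - y / 2) (1 + y) = 1 + y (1 - y) / 2 >=
    1]. *)
Lemma expRN_le_half (y : R) : 0 <= y <= 1 -> expR (- y) <= 1 - y / 2.
Proof.
move=> /andP[y0 y1]; rewrite expRN.
have e := expR_ge1Dx y.
apply: (@le_trans _ _ (1 + y)^-1).
  by rewrite lef_pV2 ?posrE ?expR_gt0//; lra.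
by rewrite -[leLHS]div1r ler_pdivrMr; nra.
Qed.

(** This choice of [h] makes [y = a_k h^2] at most 1, so the second difference [2 - 2 exp (-y)] of
    each Gaussian is at least [y]. In turn [y >= 1 / 4 + (q / 2) cos k], and the cosine averages to
    zero. *)
Lemma diff2_phi_ge theta p h : 0 < p < 1 -> cot theta != 0 ->
  h ^+ 2 = p / cot theta ^+ 2 ->
  1 / 4 <= diff2 h (phi theta p) 0.
Proof.
move=> p01 c0 hE; have /andP[p0 p1] := p01.
have [i /= ->] := iter_diff2_phi theta p h 1.
have ic : lebesgue_measure.-integrable `[0, 2 * pi]
    (EFin \o (fun k : R => (1 - p) / 2 * cos k)).
  apply: integrable_period => k; apply: cvgM; first exact: cvg_cst.
  exact: continuous_cos.
have i1 : lebesgue_measure.-integrable `[0, 2 * pi] (EFin \o cst (1 / 4 : R)).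
  by apply: integrable_period; exact: cst_continuous.
have -> : 1 / 4 = (2 * pi)^-1 * \int[lebesgue_measure]_(k in `[0, 2 * pi])
    (1 / 4 + (1 - p) / 2 * cos k) :> R.
  rewrite (RintegralD _ i1 ic)//= [X in _ + X]RintegralZl//; last first.
    exact: (integrable_period (@continuous_cos R)).
  by rewrite mean_cos mulr0 addr0 mean_cst.
rewrite ler_wpM2l ?invr_ge0 ?mulr_ge0 ?pi_ge0//; apply: le_Rintegral => //.
  exact: (integrableD _ i1 ic).
move=> k _; have /andP[w0 w1] := weight_bounds theta k p01.
rewrite /diff2 add0r sub0r sqrrN expr0n/= mulr0 oppr0 expR0 mulr1.
set y := weight theta p k * h ^+ 2.
have y0 : 0 <= y by rewrite mulr_ge0// sqr_ge0.
have y1 : y <= 1.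
  by rewrite /y hE -ler_pdivlMr ?divr_gt0 ?exprn_even_gt0// div1r invf_div.
have := @expRN_le_half y; rewrite y0 y1 => /(_ isT).
suff : 1 / 4 + (1 - p) / 2 * cos k <= y by lra.
have -> : y = (1 + 2 * (1 - p) * cos k + (1 - p) ^+ 2) / (2 * (2 - p)).
  rewrite /y hE /weight; field; rewrite c0 /=.
  by apply/andP; split; rewrite gt_eqF//; nra.
have := cos_le1 k; have := cos_geN1 k => c1 c2.
have N0 : 0 <= 1 + 2 * (1 - p) * cos k + (1 - p) ^+ 2 by nra.
rewrite ler_pdivlMr; last lra.
have := sqr_ge0 (1 - p); have := mulr_ge0 N0 (ltW p0).
set N := 1 + 2 * (1 - p) * cos k + _ => Np q2.
(* Since [2 (2 - p) <= 4], [y] is at least [N / 4]; dropping [q^2 / 4] from that leaves the claimed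
   bound. *)
apply: (@le_trans _ _ (N / 4 * (2 * (2 - p)))); last lra.
by rewrite ler_wpM2r /N; lra.
Qed.

Lemma moment_bounds theta p (mu : probability (measurableTypeR R) R) n :
  0 < p < 1 -> cot theta != 0 ->
  (forall nu, char_fun mu nu = (phi theta p nu)%:C) ->
  (cot theta ^+ 2 / 4) ^+ n / p ^+ n <= moment mu (2 * n) <=
  (4 * cot theta ^+ 2 * n%:R ^+ 2) ^+ n / p ^+ n.
Proof.
move=> p01 c0 muE; have /andP[p0 p1] := p01.
have cE y : \int[mu]_x cos (y * x) = phi theta p y by have [] := muE y.
pose B m := (4 * cot theta ^+ 2 * m%:R ^+ 2) ^+ m / p ^+ m.
(* Stated for every [m], since the lower bound also calls for integrability at [m = 1]. *)
have UB m : (\int[mu]_x (x ^+ (2 * m))%:E <= (B m)%:E)%E.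
  apply: integral_pow_le => h h0; rewrite (integral_two_sub_2cosX _ _ cE).
  exact: iter_diff2_phi_le.
have im m := integrable_pow (UB m).
have i2 : mu.-integrable [set: measurableTypeR R] (EFin \o (fun x => x ^+ 2)).
  exact: im 1%N.
apply/andP; split; last first.
  rewrite -lee_fin /moment /Rintegral fineK; first exact: UB.
  exact: integrable_fin_num (im n).
apply: le_trans (moment_ge_exprn i2 (im n)); rewrite -expr_div_n.
have c2 : 0 < cot theta ^+ 2 by rewrite exprn_even_gt0.
rewrite lerXn2r// ?nnegrE.
- by rewrite !divr_ge0// ltW.
- by apply: Rintegral_ge0 => x _; exact: sqr_ge0.
pose h := Num.sqrt (p / cot theta ^+ 2).
have hE : h ^+ 2 = p / cot theta ^+ 2 by rewrite sqr_sqrtr// divr_ge0 ?ltW.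
have := diff2_phi_ge p01 c0 hE.
rewrite -[diff2 _ _ _]/(iter 1 (diff2 h) (phi theta p) 0).
rewrite -(integral_two_sub_2cosX h 1 cE) => /le_trans H.
(* From [1 / 4 <= h^2 M_2] and the value of [h^2] follows [M_2 >= cot^2 theta / (4 p)]. *)
suff /H : \int[mu]_x (2 - 2 * cos (h * x)) ^+ 1 <= h ^+ 2 * moment mu 2.
  rewrite hE [leRHS]mulrAC ler_pdivlMr// ler_pdivrMr// => G.
  by lra.
rewrite -RintegralZl//; apply: le_Rintegral => //.
- exact: integrable_two_sub_2cosX.
- have := integrableZl measurableT (h ^+ 2) i2.
  by apply: eq_integrable => // x _; rewrite /= EFinM.
- by move=> x _; rewrite expr1 -exprMn; exact: two_sub_2cos_le.
Qed.

(** Taking logarithms bounds [ln (M p) + n ln p] between [ln a] and [ln b], while [ln p] tends to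
    minus infinity, so the quotient of the two vanishes in the limit. *)
Lemma cvg_exponent (M : R -> R) (a b : R) n : 0 < a ->
  (forall p, 0 < p < 1 -> a / p ^+ n <= M p <= b / p ^+ n) ->
  - (ln (M p) / ln p) @[p --> 0^'+] --> (n%:R : R).
Proof.
move=> a0 HM.
have b0 : 0 < b.
  (* Comparing the two bounds at the sample point [p = 1 / 2] gives [a <= b]. *)
  have h01 : 0 < (2^-1 : R) < 1 by apply/andP; split; lra.
  have /andP[/le_trans H /H] := HM _ h01.
  rewrite ler_pM2r ?invr_gt0 ?exprn_gt0 ?invr_gt0//.
  exact: lt_le_trans.
pose K := `|ln a| + `|ln b| + 1.
apply/cvgrPdist_le => e e0; near=> p.
have p0 : 0 < p by near: p; exact: nbhs_right_gt.
have p1 : p < 1 by near: p; exact: nbhs_right_lt.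
have L : ln p <= - (K / e).
  by near: p; have /cvgrNy_le := @lnNy R; apply.
have p01 : 0 < p < 1 by rewrite p0.
have l0 : ln p < 0 by exact: ln_lt0.
have /andP[Ma Mb] := HM p p01.
have pn : 0 < p ^+ n by exact: exprn_gt0.
have M0 : 0 < M p by apply: lt_le_trans Ma; rewrite divr_gt0.
have lp (c : R) : 0 < c -> ln (c / p ^+ n) = ln c - n%:R * ln p.
  by move=> c0; rewrite ln_div ?posrE// lnXn// mulr_natl.
have La : ln a - n%:R * ln p <= ln (M p).
  by rewrite -lp// ler_ln ?posrE ?divr_gt0.
have Lb : ln (M p) <= ln b - n%:R * ln p.
  by rewrite -lp// ler_ln ?posrE ?divr_gt0.
have -> : n%:R - - (ln (M p) / ln p) = (ln (M p) + n%:R * ln p) / ln p.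
  by field; rewrite lt_eqF.
rewrite normrM normfV (ltr0_norm l0) ler_pdivrMr ?oppr_gt0//.
have KL : K <= e * - ln p by rewrite mulrC -ler_pdivrMr//; lra.
apply: le_trans KL; rewrite /K ler_norml.
have := ler_norm (ln b); have := ler_norm (- ln a); rewrite normrN.
have := normr_ge0 (ln a); have := normr_ge0 (ln b).
by move=> ? ? ? ?; apply/andP; split; lra.
Unshelve. all: by end_near. Qed.

(** * Nonvanishing of the cotangent *)

Lemma sin_neq0 m (x : R) : m%:R * pi < x < m.+1%:R * pi -> sin x != 0.
Proof.
elim: m x => [|m IH] x /andP[x0 x1].
  by rewrite gt_eqF// sin_gt0_pi//; apply/andP; split; lra.
have : sin (x - pi) != 0.
  by apply: IH; move: x0 x1; rewrite -!natr1 => ? ?;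
    apply/andP; split; lra.
by rewrite sinB sinpi cospi mulr0 subr0 mulrN1 oppr_eq0.
Qed.

(** Both [sin theta] and [cos theta] are nonzero once [sin (2 theta)] is. The excluded angles cut
    the range into four open intervals, on each of which [2 theta] lies strictly between consecutive
    multiples of [pi]. *)
Lemma cot_neq0 theta : 0 <= theta < 2 * pi ->
  (forall m : nat, (m < 4)%N -> theta <> m%:R * pi / 2) -> cot theta != 0.
Proof.
move=> /andP[t0 t2] tn; have pi0 := pi_gt0 R.
suff : sin (theta *+ 2) != 0.
  rewrite sin_mulr2n mulrn_eq0/= mulf_eq0 negb_or => /andP[c0 s0].
  by rewrite mulf_neq0// invr_eq0.
have n0 := tn 0%N isT; have n1 := tn 1%N isT.
have n2 := tn 2%N isT; have n3 := tn 3%N isT.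
have [l1|l1|//] := ltgtP theta (1%:R * pi / 2).
  have [|l0|//] := ltgtP theta (0%:R * pi / 2); first by lra.
  by apply: (@sin_neq0 0); rewrite -mulr_natr; apply/andP; split; lra.
have [l2|l2|//] := ltgtP theta (2%:R * pi / 2).
  by apply: (@sin_neq0 1); rewrite -mulr_natr; apply/andP; split; lra.
have [l3|l3|//] := ltgtP theta (3%:R * pi / 2).
  by apply: (@sin_neq0 2); rewrite -mulr_natr; apply/andP; split; lra.
by apply: (@sin_neq0 3); rewrite -mulr_natr; apply/andP; split; lra.
Qed.

End CriticalExponent.

Theorem mainTheorem6 (R : realType) (theta : R)
    (theta_bounds : 0 <= theta < 2 * pi)
    (theta_neq : forall m : nat, (m < 4)%N -> theta <> m%:R * pi / 2)
    (mu : R -> probability (measurableTypeR R) R)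
    (mu_char : forall p : R, 0 < p < 1 ->
       forall nu : R, char_fun (mu p) nu = (phi theta p nu)%:C) :
  forall n : nat,
    - (ln (moment (mu p) (2 * n)) / ln p) @[p --> 0^'+] --> (n%:R : R).
Proof.
have c0 := cot_neq0 theta_bounds theta_neq.
move=> n; apply: (@cvg_exponent _ _ ((cot theta ^+ 2 / 4) ^+ n)).
  by rewrite exprn_gt0// divr_gt0// exprn_even_gt0.
by move=> p p01; apply: moment_bounds => //; exact: mu_char.
Qed.
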